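(* Let $M$ be an $H_v$-module over an $H_v$-ring $R$ and let $A=(\mu_A,\lambda_A)$ be an intuitionistic fuzzy set in $M$. Then $A$ is an intuitionistic fuzzy $H_v$-submodule of $M$ if and only if both $\mu_A$ and $\lambda_A^c$ are fuzzy $H_v$-submodules of $M$.
   Context: Hyperoperations. For a non-empty set $H$, $\mathcal P^*(H)$ is the set of non-empty subsets of $H$; a hyperoperation on $H$ is a map $*:H\times H\to\mathcal P^*(H)$. For subsets $A,B\subseteq H$ put $A*B=\bigcup_{a\in A,b\in B}a*b$, and $x*B=\{x\}*B$, $A*x=A*\{x\}$ (likewise for external hyperoperations $R\times M\to\mathcal P^*(M)$). $(H,* )$ is an $H_v$-semigroup if $(x*(y*z))\cap((x*y)*z)\neq\emptyset$ for all $x,y,z\in H$; it is an $H_v$-group if moreover $a*H=H*a=H$ for all $a\in H$. It is weak commutative if $(x*y)\cap(y*x)\ne\emptyset$ for all $x,y$. An $H_v$-ring is a set $R$ with hyperoperations $+,\cdot$ such that $(R,+)$ is an $H_v$-group, $(R,\cdot)$ is an $H_v$-semigroup, and $(x\cdot(y+z))\cap(x\cdot y+x\cdot z)\neq\emptyset$, $((x+y)\cdot z)\cap(x\cdot z+y\cdot z)\ne\emptyset$ for all $x,y,z\in R$. An $H_v$-module over an $H_v$-ring $R$ is a non-empty set $M$ with a hyperoperation $+$ making $(M,+)$ a weak commutative $H_v$-group and a map $\cdot:R\times M\to\mathcal P^*(M)$ such that for all $a,b\in R$, $x,y\in M$: $(a\cdot(x+y))\cap(a\cdot x+a\cdot y)\ne\emptyset$,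 $((a+b)\cdot x)\cap(a\cdot x+b\cdot x)\neq\emptyset$, $((ab)\cdot x)\cap(a\cdot(b\cdot x))\ne\emptyset$. Fuzzy sets. A fuzzy set in $X$ is a map $\mu:X\to[0,1]$; its complement is $\mu^c(x)=1-\mu(x)$. An intuitionistic fuzzy set in $X$ is a pair $A=(\mu_A,\lambda_A)$ of fuzzy sets in $X$ with $0\le\mu_A(x)+\lambda_A(x)\le1$ for all $x\in X$. A fuzzy set $\mu$ in $M$ is a fuzzy $H_v$-submodule of $M$ if: (1) $\min\{\mu(x),\mu(y)\}\le\inf\{\mu(z)\mid z\in x+y\}$ for all $x,y\in M$; (2) for all $x,a\in M$ there exists $y\in M$ with $x\in a+y$ and $\min\{\mu(a),\mu(x)\}\le\mu(y)$; (3) for all $x,a\in M$ there exists $z\in M$ with $x\in z+a$ and $\min\{\mu(a),\mu(x)\}\le\mu(z)$; (4) $\mu(x)\le\inf\{\mu(z)\mid z\in r\cdot x\}$ for all $x\in M$, $r\in R$. An intuitionistic fuzzy set $A=(\mu_A,\lambda_A)$ in $M$ is an intuitionistic fuzzy $H_v$-submodule of $M$ if: (1) $\min\{\mu_A(x),\mu_A(y)\}\le\inf\{\mu_A(z)\mid z\in x+y\}$ for all $x,y\in M$; (2) for all $x,a\in M$ there exist $y,z\in M$ with $x\in(a+y)\cap(z+a)$ and $\min\{\mu_A(a),\mu_A(x)\}\le\min\{\mu_A(y),\mu_A(z)\}$; (3) $\mu_A(x)\le\inf\{\mu_A(z)\mid z\in r\cdot x\}$ for all $x\in M$, $r\in R$;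 (4) $\sup\{\lambda_A(z)\mid z\in x+y\}\le\max\{\lambda_A(x),\lambda_A(y)\}$ for all $x,y\in M$; (5) for all $x,a\in M$ there exist $y,z\in M$ with $x\in(a+y)\cap(z+a)$ and $\max\{\lambda_A(y),\lambda_A(z)\}\le\max\{\lambda_A(a),\lambda_A(x)\}$; (6) $\sup\{\lambda_A(z)\mid z\in r\cdot x\}\le\lambda_A(x)$ for all $x\in M$, $r\in R$. *)

(* Defs.v *)
From HB Require Import structures.
From mathcomp Require Import all_boot all_order all_algebra.
From mathcomp Require Import boolp classical_sets reals.

Set Implicit Arguments.
Unset Strict Implicit.
Unset Printing Implicit Defensive.

Import Order.TTheory GRing.Theory Num.Theory.
Local Open Scope classical_set_scope.
Local Open Scope ring_scope.

Record nonempty_set (T : Type) := NonemptySet {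
  nset_val :> set T;
  nset_neq0 : nset_val !=set0 }.

Definition hyperop (H : Type) := H -> H -> nonempty_set H.

Definition hlift (X Y Z : Type) (op : X -> Y -> nonempty_set Z)
    (A : set X) (B : set Y) : set Z :=
  \bigcup_(a in A) \bigcup_(b in B) op a b.

Definition is_hv_semigroup (H : Type) (op : hyperop H) : Prop :=
  forall x y z : H,
    hlift op [set x] (op y z) `&` hlift op (op x y) [set z] !=set0.

Definition is_hv_group (H : Type) (op : hyperop H) : Prop :=
  is_hv_semigroup op /\
  forall a : H, hlift op [set a] setT = setT /\ hlift op setT [set a] = setT.

Definition weak_commutative (H : Type) (op : hyperop H) : Prop :=
  forall x y : H, op x y `&` op y x !=set0.

Record hvRing := HvRing {
  hvr_car :> Type;
  hvr_add : hyperop hvr_car;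
  hvr_mul : hyperop hvr_car;
  hvr_neq0 : [set: hvr_car] !=set0;
  hvr_addP : is_hv_group hvr_add;
  hvr_mulP : is_hv_semigroup hvr_mul;
  hvr_distl : forall x y z : hvr_car,
    hlift hvr_mul [set x] (hvr_add y z)
      `&` hlift hvr_add (hvr_mul x y) (hvr_mul x z) !=set0;
  hvr_distr : forall x y z : hvr_car,
    hlift hvr_mul (hvr_add x y) [set z]
      `&` hlift hvr_add (hvr_mul x z) (hvr_mul y z) !=set0 }.

Record hvModule (R : hvRing) := HvModule {
  hvm_car :> Type;
  hvm_add : hyperop hvm_car;
  hvm_scale : R -> hvm_car -> nonempty_set hvm_car;
  hvm_neq0 : [set: hvm_car] !=set0;
  hvm_addP : is_hv_group hvm_add;
  hvm_addC : weak_commutative hvm_add;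
  hvm_scaleDr : forall (a : R) (x y : hvm_car),
    hlift hvm_scale [set a] (hvm_add x y)
      `&` hlift hvm_add (hvm_scale a x) (hvm_scale a y) !=set0;
  hvm_scaleDl : forall (a b : R) (x : hvm_car),
    hlift hvm_scale (hvr_add a b) [set x]
      `&` hlift hvm_add (hvm_scale a x) (hvm_scale b x) !=set0;
  hvm_scaleA : forall (a b : R) (x : hvm_car),
    hlift hvm_scale (hvr_mul a b) [set x]
      `&` hlift hvm_scale [set a] (hvm_scale b x) !=set0 }.

Record fuzzySet (K : realType) (X : Type) := FuzzySet {
  fuzzy_val :> X -> K;
  fuzzy_itv : forall x, 0 <= fuzzy_val x <= 1 }.

Lemma fcompl_subproof (K : realType) (X : Type) (mu : fuzzySet K X) (x : X) :
  0 <= 1 - mu x <= 1.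
Proof.
by have /andP[mu0 mu1] := fuzzy_itv mu x; rewrite subr_ge0 mu1 gerBl mu0.
Qed.

Definition fcompl (K : realType) (X : Type) (mu : fuzzySet K X) :
  fuzzySet K X := FuzzySet (fcompl_subproof mu).

Record ifSet (K : realType) (X : Type) := IfSet {
  if_mu : fuzzySet K X;
  if_lambda : fuzzySet K X;
  if_sum : forall x, 0 <= if_mu x + if_lambda x <= 1 }.

(* The infima and suprema below are taken over nonempty subsets of [0, 1], on
   which the total operators inf and sup have their usual meaning. *)

Record fuzzy_hv_submodule (K : realType) (R : hvRing) (M : hvModule R)
    (mu : fuzzySet K M) : Prop := FuzzyHvSubmodule {
  fhs_add : forall x y : M,
    Num.min (mu x) (mu y) <= inf [set mu z | z in (hvm_add x y : set M)];
  fhs_right : forall x a : M, exists y : M,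
    (hvm_add a y : set M) x /\ Num.min (mu a) (mu x) <= mu y;
  fhs_left : forall x a : M, exists z : M,
    (hvm_add z a : set M) x /\ Num.min (mu a) (mu x) <= mu z;
  fhs_scale : forall (x : M) (r : R),
    mu x <= inf [set mu z | z in (hvm_scale r x : set M)] }.

Record if_hv_submodule (K : realType) (R : hvRing) (M : hvModule R)
    (A : ifSet K M) : Prop := IfHvSubmodule {
  ifhs_mu_add : forall x y : M,
    Num.min (if_mu A x) (if_mu A y)
      <= inf [set if_mu A z | z in (hvm_add x y : set M)];
  ifhs_mu_solve : forall x a : M, exists y z : M,
    (hvm_add a y `&` hvm_add z a) x /\
    Num.min (if_mu A a) (if_mu A x) <= Num.min (if_mu A y) (if_mu A z);
  ifhs_mu_scale : forall (x : M) (r : R),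
    if_mu A x <= inf [set if_mu A z | z in (hvm_scale r x : set M)];
  ifhs_lambda_add : forall x y : M,
    sup [set if_lambda A z | z in (hvm_add x y : set M)]
      <= Num.max (if_lambda A x) (if_lambda A y);
  ifhs_lambda_solve : forall x a : M, exists y z : M,
    (hvm_add a y `&` hvm_add z a) x /\
    Num.max (if_lambda A y) (if_lambda A z)
      <= Num.max (if_lambda A a) (if_lambda A x);
  ifhs_lambda_scale : forall (x : M) (r : R),
    sup [set if_lambda A z | z in (hvm_scale r x : set M)]
      <= if_lambda A x }.

(* Main.v *)
Require Import Defs.
From HB Require Import structures.
From mathcomp Require Import all_boot all_order all_algebra.
From mathcomp Require Import boolp classical_sets reals.

Import Order.TTheory GRing.Theory Num.Theory.
Local Open Scope classical_set_scope.
Local Open Scope ring_scope.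

(** The reflection [t |-> 1 - t] reverses the order of [0, 1], so it swaps min with max and inf with
    sup. Hence the fuzzy submodule conditions on the complement of [lambda] are the three conditions
    on [lambda] itself ([fuzzy_hv_submodule_fcomplP]), while those on [mu] match once left and right
    solvability are merged ([fuzzy_hv_submoduleP]). *)

(** The image of [S] is nonempty and bounded below by 0, so its [inf] is a true greatest lower bound
    and comparing with it is a pointwise matter. *)
Lemma le_inf_fuzzyP (K : realType) (X : Type) (mu : fuzzySet K X)
    (S : nonempty_set X) (c : K) :
  c <= inf [set mu z | z in (S : set X)] <-> forall z, (S : set X) z -> c <= mu z.
Proof.
have [z0 Sz0] := nset_neq0 S.
have lbE : has_lbound [set mu z | z in (S : set X)].
  by exists 0 => _ [z _ <-]; have /andP[] := fuzzy_itv mu z.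
split=> [cinf z Sz|cle].
  by apply: le_trans cinf _; apply: ge_inf => //; exists z.
by apply: lb_le_inf; [exists (mu z0), z0|move=> _ [z Sz <-]; apply: cle].
Qed.

Lemma sup_fuzzy_leP (K : realType) (X : Type) (mu : fuzzySet K X)
    (S : nonempty_set X) (c : K) :
  sup [set mu z | z in (S : set X)] <= c <-> forall z, (S : set X) z -> mu z <= c.
Proof.
have [z0 Sz0] := nset_neq0 S.
have ubE : has_ubound [set mu z | z in (S : set X)].
  by exists 1 => _ [z _ <-]; have /andP[] := fuzzy_itv mu z.
split=> [supc z Sz|lec].
  by apply: le_trans supc; apply: ub_le_sup => //; exists z.
by apply: ge_sup; [exists (mu z0), z0|move=> _ [z Sz <-]; apply: lec].
Qed.

(** Both sides reduce to pointwise bounds, where [1 - c <= 1 - mu z] amounts to [mu z <= c]; no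
    identity between [inf] and [sup] has to be proved. *)
Lemma le_inf_fcomplP (K : realType) (X : Type) (mu : fuzzySet K X)
    (S : nonempty_set X) (c : K) :
  1 - c <= inf [set fcompl mu z | z in (S : set X)] <->
  sup [set mu z | z in (S : set X)] <= c.
Proof.
split=> [/le_inf_fuzzyP h|/sup_fuzzy_leP h].
  by apply/sup_fuzzy_leP => z /h; rewrite /= lerD2l lerN2.
by apply/le_inf_fuzzyP => z /h; rewrite /= lerD2l lerN2.
Qed.

Lemma min_fcompl (K : realType) (X : Type) (mu : fuzzySet K X) (x y : X) :
  Num.min (fcompl mu x) (fcompl mu y) = 1 - Num.max (mu x) (mu y).
Proof. by rewrite oppr_max addr_minr. Qed.

(* The two one-sided solvability conditions involve independent witnesses, so
   they can be merged into a single condition. *)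
Lemma fuzzy_hv_submoduleP (K : realType) (R : hvRing) (M : hvModule R)
    (mu : fuzzySet K M) :
  fuzzy_hv_submodule mu <->
  [/\ forall x y : M,
        Num.min (mu x) (mu y) <= inf [set mu z | z in (hvm_add x y : set M)],
      forall x a : M, exists y z : M, (hvm_add a y `&` hvm_add z a) x /\
        Num.min (mu a) (mu x) <= Num.min (mu y) (mu z)
    & forall (x : M) (r : R),
        mu x <= inf [set mu z | z in (hvm_scale r x : set M)]].
Proof.
split=> [[hadd hr hl hscale]|[hadd hsolve hscale]].
  split=> // x a; have [y [xy ley]] := hr x a; have [z [xz lez]] := hl x a.
  by exists y, z; split; [split|rewrite le_min ley lez].
split=> // x a; have [y [z [[xy xz]]]] := hsolve x a.
  by rewrite le_min => /andP[ley _]; exists y.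
by rewrite le_min => /andP[_ lez]; exists z.
Qed.

Lemma fuzzy_hv_submodule_fcomplP (K : realType) (R : hvRing) (M : hvModule R)
    (lam : fuzzySet K M) :
  fuzzy_hv_submodule (fcompl lam) <->
  [/\ forall x y : M,
        sup [set lam z | z in (hvm_add x y : set M)] <= Num.max (lam x) (lam y),
      forall x a : M, exists y z : M, (hvm_add a y `&` hvm_add z a) x /\
        Num.max (lam y) (lam z) <= Num.max (lam a) (lam x)
    & forall (x : M) (r : R),
        sup [set lam z | z in (hvm_scale r x : set M)] <= lam x].
Proof.
split=> [/fuzzy_hv_submoduleP[hadd hsolve hscale]|[hadd hsolve hscale]].
  (* [fcompl lam x] is [1 - lam x] by conversion, so [le_inf_fcomplP] applies with [c] equal to
     [lam x]; for sums, [min_fcompl] first exhibits [c] as a maximum. *)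
  split=> [x y|x a|x r]; last exact/le_inf_fcomplP/hscale.
    by apply/le_inf_fcomplP; rewrite -min_fcompl; apply: hadd.
  have [y [z [xyz le_yz]]] := hsolve x a; exists y, z; split=> //.
  by move: le_yz; rewrite !min_fcompl lerD2l lerN2.
apply/fuzzy_hv_submoduleP; split=> [x y|x a|x r]; last exact/le_inf_fcomplP/hscale.
  by rewrite min_fcompl; apply/le_inf_fcomplP/hadd.
have [y [z [xyz le_yz]]] := hsolve x a; exists y, z; split=> //.
by rewrite !min_fcompl lerD2l lerN2.
Qed.

Theorem corollary4p5 (K : realType) (R : hvRing) (M : hvModule R)
    (A : ifSet K M) :
  if_hv_submodule A <->
  fuzzy_hv_submodule (if_mu A) /\ fuzzy_hv_submodule (fcompl (if_lambda A)).
Proof.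
split=> [[? ? ? ? ? ?]|].
  by split; [apply/fuzzy_hv_submoduleP|apply/fuzzy_hv_submodule_fcomplP].
by case=> /fuzzy_hv_submoduleP[? ? ?] /fuzzy_hv_submodule_fcomplP[? ? ?].
Qed.
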